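(* Fix $(x,t)$, where $x=(a,u)\in\mathbb{R}^{d_a}\times\mathbb{R}^{d_u}$, and define the responsibilities $$w_n(x,t)=\frac{\varphi\big(x-\alpha_t x_0^{(n)}\big)}{\sum_{j=1}^N\varphi\big(x-\alpha_t x_0^{(j)}\big)},\qquad n\in[N]=\{1,\dots,N\}.$$ Assume there exists an index $k\in[N]$ such that $$\sum_{j\neq k}\varphi\big(x-\alpha_t x_0^{(j)}\big)\le \eta\,\varphi\big(x-\alpha_t x_0^{(k)}\big)$$ for some $\eta\in(0,1)$. Then the responsibility gradients satisfy $$\big\|\partial_a w_k(x,t)\big\|=O(\eta),\qquad \sum_{j\neq k}\big\|\partial_a w_j(x,t)\big\|=O(\eta),$$ which vanishes as $\eta\to 0$.
   Context: The points $x_0^{(1)},\dots,x_0^{(N)}\in\mathbb{R}^d$, with $d=d_a+d_u$, are paired training samples of the clean joint variable $x_0=(a,u)$, where $a\in\mathbb{R}^{d_a}$ is the (discretized) coefficient and $u\in\mathbb{R}^{d_u}$ the (discretized) solution. The time-dependent coefficients $\alpha_t$ and $\sigma=\sigma(t)$ are the scale and noise level of the diffusion process at time $t$. The isotropic Gaussian kernel on $\mathbb{R}^d$ is $\varphi(r)=(2\pi\sigma^2)^{-d/2}\exp\big(-\|r\|_2^2/(2\sigma^2)\big)$, so that $w_n(x,t)$ is the responsibility of the $n$-th component of the Gaussian mixture $\frac1N\sum_{n=1}^N\mathcal N(x;\alpha_t x_0^{(n)},\sigma^2 I)$ at $x$, and $\sum_{n=1}^N w_n(x,t)=1$. Here $\partial_a$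 denotes the gradient with respect to the $a$-component of $x$. *)

(* Defs.v *)
From HB Require Import structures.
From mathcomp Require Import all_boot all_order all_algebra.
From mathcomp Require Import all_classical all_reals all_analysis.
Set Implicit Arguments.
Unset Strict Implicit.
Unset Printing Implicit Defensive.
Import Order.TTheory GRing.Theory Num.Theory.
Import numFieldNormedType.Exports.
Local Open Scope classical_set_scope.
Local Open Scope ring_scope.

(* The library's norm on matrices is the sup norm, hence this definition. *)
Definition norm2 (R : realType) (n : nat) (v : 'rV[R]_n) : R :=
  Num.sqrt (\sum_(i < n) v ord0 i ^+ 2).

Definition gauss_kernel (R : realType) (d : nat) (s : R) (r : 'rV[R]_d) : R :=
  (2 * pi * s ^+ 2) `^ (- (d%:R / 2)) *
  expR (- (norm2 r ^+ 2 / (2 * s ^+ 2))).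

Section responsibility.
Context (R : realType) (N d : nat).
Variables (alpha sigma : R -> R) (x0 : 'I_N -> 'rV[R]_d).

(* The unnormalized weight [phi (x - alpha_t x0^(n))]; [phi] depends on [t]
   through [sigma t]. *)
Definition component (t : R) (x : 'rV[R]_d) (n : 'I_N) : R :=
  gauss_kernel (sigma t) (x - alpha t *: x0 n).

Definition responsibility (t : R) (x : 'rV[R]_d) (n : 'I_N) : R :=
  component t x n / \sum_(j < N) component t x j.

Definition dominant (t : R) (x : 'rV[R]_d) (eta : R) (k : 'I_N) : Prop :=
  \sum_(j < N | j != k) component t x j <= eta * component t x k.

End responsibility.

Definition grad (R : realType) (n : nat) (f : 'rV[R]_n -> R) (a : 'rV[R]_n) :
    'rV[R]_n :=
  \row_(i < n) 'D_(delta_mx ord0 i) f a.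

(* The joint variable [x = (a, u)] is [row_mx a u]; [grad_a f a u] is the
   gradient of [f] at [(a, u)] with respect to [a], with [u] held fixed. *)
Definition grad_a (R : realType) (da du : nat) (f : 'rV[R]_(da + du) -> R)
    (a : 'rV[R]_da) (u : 'rV[R]_du) : 'rV[R]_da :=
  grad (fun a' : 'rV[R]_da => f (row_mx a' u)) a.

(* Main.v *)
Require Import Defs.
From HB Require Import structures.
From mathcomp Require Import all_boot all_order all_algebra.
From mathcomp Require Import all_classical all_reals all_analysis.
From mathcomp Require Import ring.
Set Implicit Arguments.
Unset Strict Implicit.
Unset Printing Implicit Defensive.
Import Order.TTheory GRing.Theory Num.Theory.
Import numFieldNormedType.Exports.
Local Open Scope classical_set_scope.
Local Open Scope ring_scope.

(** Write [p_n] for the mixture components and [g_n = grad_a p_n / p_n] for their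
    scores.  Differentiating [w_n = p_n / sum_j p_j] gives
      [grad_a w_n = w_n * sum_j w_j (g_n - g_j)],
    where [g_n - g_j = alpha_t (a_n - a_j) / sigma_t^2], with [a_n] the
    [a]-component of the [n]-th sample, does not depend on the point.  The term
    [j = n] vanishes, so [|grad_a w_n| <= C w_n sum_(j != n) w_j].  Dominance
    gives [sum_(j != k) w_j <= eta]: for [n = k] this bounds the second factor,
    and for [n != k] it bounds the sum of the first factors. *)

(** * Euclidean norm and derivatives of coordinates and exponentials *)

Lemma norm2_sqr (R : realType) n (v : 'rV[R]_n) :
  norm2 v ^+ 2 = \sum_(i < n) v ord0 i ^+ 2.
Proof. by rewrite sqr_sqrtr// sumr_ge0// => i _; exact: sqr_ge0. Qed.

(** Each [|v_i|] is at most the whole sum, so the squares add up to at most its square. Gradients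
    can then be bounded one coordinate at a time. *)
Lemma norm2_le_sum (R : realType) n (v : 'rV[R]_n) :
  norm2 v <= \sum_(i < n) `|v ord0 i|.
Proof.
have sum_ge0 : 0 <= \sum_(i < n) `|v ord0 i| by exact: sumr_ge0.
rewrite -(ger0_norm sum_ge0) -sqrtr_sqr ler_sqrt ?sqr_ge0// expr2 mulr_suml.
apply: ler_sum => i _; rewrite -real_normK ?num_real// expr2.
by rewrite ler_wpM2l// (bigD1 i)//= lerDl sumr_ge0.
Qed.

Lemma is_derive_coord (R : realType) m n (M V : 'M[R]_(m, n)) i j :
  is_derive M V (fun X : 'M[R]_(m, n) => X i j) (V i j).
Proof.
have dM := @differentiable_coord R m n M i j.
apply: DeriveDef; first exact: diff_derivable.
(* A continuous linear map is its own differential. *)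
pose f (X : 'M[R]_(m, n)) := X i j.
have f_lin : linear f by move=> c X Y; rewrite /f !mxE.
pose fL : {linear 'M[R]_(m, n) -> R} :=
  HB.pack f (GRing.isLinear.Build _ _ _ _ _ f_lin).
rewrite deriveE// -[fun _ => _]/(fL : _ -> _) diff_lin//.
exact: coord_continuous.
Qed.

Section row_mx_coordinate.
Context (R : realType) (m n : nat) (u : 'rV[R]_n).
Implicit Types (a v : 'rV[R]_m) (i : 'I_(m + n)).

Lemma differentiable_row_mxl a i :
  differentiable (fun b : 'rV[R]_m => row_mx b u ord0 i) a.
Proof.
case: (split_ordP i) => k ->.
- by under eq_fun do rewrite row_mxEl; exact: differentiable_coord.
- by under eq_fun do rewrite row_mxEr; exact: differentiable_cst.
Qed.

Lemma is_derive_row_mxl a v i :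
  is_derive a v (fun b : 'rV[R]_m => row_mx b u ord0 i)
    (row_mx v (0 : 'rV[R]_n) ord0 i).
Proof.
case: (split_ordP i) => k ->.
- by under eq_fun do rewrite row_mxEl; rewrite row_mxEl; exact: is_derive_coord.
- by under eq_fun do rewrite row_mxEr; rewrite row_mxEr mxE; exact: is_derive_cst.
Qed.

End row_mx_coordinate.

Lemma differentiable_expR_comp (R : realType) (V : normedModType R)
    (f : V -> R) (x : V) :
  differentiable f x -> differentiable (expR \o f) x.
Proof.
move=> df; apply: differentiable_comp => //.
exact/derivable1_diffP/derivable_expR.
Qed.

Lemma derive_expR_comp (R : realType) (V : normedModType R)
    (f : V -> R) (x v : V) :
  differentiable f x -> 'D_v (expR \o f) x = 'D_v f x * expR (f x).
Proof.
move=> df; have de : differentiable (expR : R -> R) (f x).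
  exact/derivable1_diffP/derivable_expR.
rewrite deriveE; last exact: differentiable_expR_comp.
rewrite diff_comp// (@diff1E R R)//= deriveE//.
rewrite derive1E; congr (_ * _); exact: derive_val.
Qed.

(** * Derivatives of normalized positive weights *)

Section normalized_weights.
Context (R : realType) (V : normedModType R) (N : nat) (p : 'I_N -> V -> R).
Hypothesis p_gt0 : forall j x, 0 < p j x.

Let w n x := p n x / \sum_(j < N) p j x.

Lemma sum_weights_gt0 (n : 'I_N) x : 0 < \sum_(j < N) p j x.
Proof.
rewrite (bigD1 n)//= ltr_pwDl ?p_gt0//.
by apply: sumr_ge0 => j _; exact: ltW.
Qed.

Lemma normalized_weight_ge0 n x : 0 <= w n x.
Proof. by rewrite divr_ge0 ?ltW// (sum_weights_gt0 n). Qed.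

Lemma sum_normalized_weights (n : 'I_N) x : \sum_(j < N) w j x = 1.
Proof. by rewrite -mulr_suml divff// gt_eqF// (sum_weights_gt0 n). Qed.

Lemma normalized_weight_le1 n x : w n x <= 1.
Proof.
rewrite -(sum_normalized_weights n x) (bigD1 n)//= lerDl.
by apply: sumr_ge0 => j _; exact: normalized_weight_ge0.
Qed.

(** The normalizing sum is at least [p k x], so dividing by it keeps the bound. *)
Lemma sum_others_le (eta : R) k x : 0 <= eta ->
  \sum_(j < N | j != k) p j x <= eta * p k x ->
  \sum_(j < N | j != k) w j x <= eta.
Proof.
move=> eta_ge0 dom; rewrite -mulr_suml ler_pdivrMr ?(sum_weights_gt0 k)//.
apply: (le_trans dom); rewrite ler_wpM2l// (bigD1 k)//= lerDl.
by apply: sumr_ge0 => j _; exact: ltW.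
Qed.

Lemma differentiable_normalized_weight n x :
  (forall j, differentiable (p j) x) -> differentiable (w n) x.
Proof.
move=> dp; apply: differentiableM => //; apply: differentiableV.
- have -> : (fun y => \sum_(j < N) p j y) = \sum_(j < N) p j.
    by apply/funext => y; rewrite fct_sumE.
  exact: differentiable_sum.
- by rewrite gt_eqF// (sum_weights_gt0 n).
Qed.

(** Writing [S] for the normalizing sum, the product rule on [p n = w n * S] gives an equation to
    solve for the derivative of [w n], with no quotient to differentiate. *)
Lemma derive_normalized_weight (g : 'I_N -> R) n x v :
  (forall j, differentiable (p j) x) ->
  (forall j, 'D_v (p j) x = g j * p j x) ->
  'D_v (w n) x = w n x * \sum_(j < N) w j x * (g n - g j).
Proof.
move=> dp Dp.
pose S := \sum_(j < N) p j.
have SE y : S y = \sum_(j < N) p j y by rewrite /S fct_sumE.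
have S_gt0 y : 0 < S y by rewrite SE (sum_weights_gt0 n).
have pE : p n = w n * S.
  by apply/funext => y; rewrite -[RHS]/(w n y * S y) /w -SE divfK// gt_eqF.
have DS : 'D_v S x = \sum_(j < N) g j * p j x.
  rewrite /S derive_sum => [|j]; last exact: diff_derivable.
  by apply: eq_bigr => j _; rewrite Dp.
have dw : derivable (w n) x v.
  exact/diff_derivable/differentiable_normalized_weight.
have dS : derivable S x v.
  by apply: derivable_sum => j; exact: diff_derivable.
have pxE j : p j x = w j x * S x by rewrite /w SE divfK// -SE gt_eqF.
have := Dp n; rewrite [in LHS]pE (deriveM dw dS) DS -![_ *: _]/(_ * _).
under eq_bigr do rewrite pxE mulrA.
rewrite -mulr_suml pxE => Dpn.
have Sx0 : S x != 0 by rewrite gt_eqF.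
apply: (mulfI Sx0).
(* The weights sum to 1, so [g n] leaves the sum. *)
under [in RHS]eq_bigr do rewrite mulrBr.
rewrite sumrB -mulr_suml (sum_normalized_weights n) mul1r.
under [in RHS]eq_bigr do rewrite mulrC.
move/(canRL (addKr _)): Dpn => ->; ring.
Qed.

End normalized_weights.

(** * Scores of the Gaussian components *)

Section gaussian_weights.
Context (R : realType) (N da du : nat) (alpha sigma : R -> R).
Context (x0 : 'I_N -> 'rV[R]_(da + du)) (t : R) (u : 'rV[R]_du).
Hypothesis sigma_gt0 : 0 < sigma t.

Let p n (a : 'rV[R]_da) := component alpha sigma x0 t (row_mx a u) n.

Let dist2 n i (a : 'rV[R]_da) : R :=
  (row_mx a u ord0 i - (alpha t *: x0 n) ord0 i) ^+ 2.

Let expnt n (a : 'rV[R]_da) : R :=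
  (- (2 * sigma t ^+ 2))^-1 * \sum_(i < da + du) dist2 n i a.

Lemma componentE n a :
  p n a = (2 * pi * sigma t ^+ 2) `^ (- ((da + du)%:R / 2)) *
          expR (expnt n a).
Proof.
have sumE : \sum_(i < da + du) (row_mx a u - alpha t *: x0 n) ord0 i ^+ 2 =
    \sum_(i < da + du) dist2 n i a.
  by apply: eq_bigr => i _; rewrite /dist2 [in LHS]mxE [X in _ + X]mxE.
by rewrite /p /component /gauss_kernel norm2_sqr sumE /expnt invrN mulNr
  [X in expR (- X)]mulrC.
Qed.

Lemma component_gt0 n a : 0 < p n a.
Proof.
by rewrite componentE mulr_gt0 ?expR_gt0// powR_gt0// !mulr_gt0// ?pi_gt0// exprn_gt0.
Qed.

(** An identity between functions, not values, so that the differentiation rules for powers and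
    differences apply. *)
Let dist2E n i : dist2 n i =
  ((fun b => row_mx b u ord0 i) - cst ((alpha t *: x0 n) ord0 i)) ^+ 2.
Proof. by apply/funext => b; rewrite !expr2. Qed.

Let differentiable_dist2 n i a : differentiable (dist2 n i) a.
Proof.
rewrite dist2E; apply: differentiableX; apply: differentiableB => //.
exact: differentiable_row_mxl.
Qed.

Let derive_dist2 n i a v : 'D_v (dist2 n i) a =
  2 * (row_mx a u ord0 i - (alpha t *: x0 n) ord0 i) *
  row_mx v (0 : 'rV[R]_du) ord0 i.
Proof.
have d1 := is_derive_row_mxl u a v i.
by rewrite dist2E derive_val subr0 expr1.
Qed.

Let expntE n : expnt n = (- (2 * sigma t ^+ 2))^-1 \*: \sum_(i < da + du) dist2 n i.
Proof. by apply/funext => a; rewrite /= fct_sumE. Qed.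

Let componentZ n : p n =
  (2 * pi * sigma t ^+ 2) `^ (- ((da + du)%:R / 2)) \*: (expR \o expnt n).
Proof. by apply/funext => a; rewrite componentE. Qed.

Let differentiable_expnt n a : differentiable (expnt n) a.
Proof. by rewrite expntE; apply: differentiableZ; exact: differentiable_sum. Qed.

Lemma differentiable_component n a : differentiable (p n) a.
Proof.
by rewrite componentZ; apply: differentiableZ; exact: differentiable_expR_comp.
Qed.

(** The factor of [p n a] is coordinate [i] of the score [g_n]; its dependence on [a] is the same
    for every [n]. *)
Lemma derive_component n a (i : 'I_da) :
  'D_(delta_mx ord0 i) (p n) a =
  (alpha t * x0 n ord0 (lshift du i) - a ord0 i) / sigma t ^+ 2 * p n a.
Proof.
have dsum : differentiable (\sum_(j < da + du) dist2 n j) a.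
  exact: differentiable_sum.
rewrite componentZ deriveZ; last exact/diff_derivable/differentiable_expR_comp.
rewrite derive_expR_comp//= [X in 'D__ X _]expntE.
rewrite deriveZ; last exact: diff_derivable.
rewrite derive_sum => [|j]; last exact: diff_derivable.
under eq_bigr do rewrite derive_dist2.
(* The direction has no [u]-part, and its [a]-part is a basis vector, so a single summand
   survives. *)
rewrite big_split_ord/= [X in _ + X]big1 ?addr0; last first.
  by move=> j _; rewrite [X in _ * X]row_mxEr [X in _ * X]mxE mulr0.
rewrite (bigD1 i)//= big1 ?addr0; last first.
  by move=> j ji; rewrite [X in _ * X]row_mxEl [X in _ * X]mxE eqxx/= (negPf ji) mulr0.
rewrite !row_mxEl !mxE !eqxx/= mulr1 -![_ *: _]/(_ * _).
have s0 : sigma t != 0 by rewrite gt_eqF.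
by field.
Qed.

End gaussian_weights.

(** * Bounds on the responsibility gradients *)

Section responsibility_gradient.
Context (R : realType) (N da du : nat) (alpha sigma : R -> R).
Context (x0 : 'I_N -> 'rV[R]_(da + du)) (t : R).
Hypothesis sigma_gt0 : 0 < sigma t.

Let w n x := responsibility alpha sigma x0 t x n.

Definition score_gap (n j : 'I_N) (i : 'I_da) : R :=
  alpha t * (x0 n ord0 (lshift du i) - x0 j ord0 (lshift du i)) / sigma t ^+ 2.

(** This is the constant in O(eta). A sum over all pairs serves as a crude upper bound for every
    single pair. *)
Definition total_score_gap : R :=
  \sum_(n < N) \sum_(j < N) \sum_(i < da) `|score_gap n j i|.

Lemma score_gap_self n i : score_gap n n i = 0.
Proof. by rewrite /score_gap subrr mulr0 mul0r. Qed.

Lemma total_score_gap_ge0 : 0 <= total_score_gap.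
Proof. by do 3!apply: sumr_ge0 => ? _. Qed.

Lemma sum_score_gap_le n j : \sum_(i < da) `|score_gap n j i| <= total_score_gap.
Proof.
rewrite /total_score_gap (bigD1 n)//= (bigD1 j)//= -addrA lerDl.
by rewrite addr_ge0// sumr_ge0// => ? _; do ?[apply: sumr_ge0 => ? _].
Qed.

Lemma differentiable_responsibility n a u :
  differentiable (fun b : 'rV[R]_da => w n (row_mx b u)) a.
Proof.
apply: differentiable_normalized_weight => [j b|j].
- exact: component_gt0.
- exact: differentiable_component.
Qed.

(* [a] cancels in the difference of two component scores; this is what makes
   the bound uniform in the base point. *)
Lemma grad_a_responsibilityE n a u i :
  grad_a (w n) a u ord0 i =
  w n (row_mx a u) * \sum_(j < N) w j (row_mx a u) * score_gap n j i.
Proof.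
rewrite /grad_a /grad mxE.
rewrite (@derive_normalized_weight _ _ _ _ _ (fun j =>
  (alpha t * x0 j ord0 (lshift du i) - a ord0 i) / sigma t ^+ 2)).
- congr (_ * _); apply: eq_bigr => j _; congr (_ * _).
  by rewrite /score_gap; ring.
- by move=> *; exact: component_gt0.
- by move=> j; exact: differentiable_component.
- by move=> j; exact: derive_component.
Qed.

Lemma norm2_grad_a_le n a u :
  norm2 (grad_a (w n) a u) <=
  total_score_gap * (w n (row_mx a u) * \sum_(j < N | j != n) w j (row_mx a u)).
Proof.
have w_ge0 j : 0 <= w j (row_mx a u).
  by apply: (@normalized_weight_ge0 _ _ _ (fun j b => component alpha sigma x0 t
    (row_mx b u) j)) => *; exact: component_gt0.
apply: (le_trans (norm2_le_sum _)).
under eq_bigr do rewrite grad_a_responsibilityE normrM ger0_norm//.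
rewrite -mulr_sumr mulrCA ler_wpM2l// mulr_sumr.
apply: (@le_trans _ _ (\sum_(i < da) \sum_(j < N | j != n)
    w j (row_mx a u) * `|score_gap n j i|)).
  apply: ler_sum => i _; rewrite (bigD1 n)//= score_gap_self mulr0 add0r.
  apply: (le_trans (ler_norm_sum _ _ _)); apply: ler_sum => j _.
  by rewrite normrM ger0_norm.
rewrite exchange_big/=; apply: ler_sum => j _.
by rewrite -mulr_sumr mulrC ler_wpM2r// sum_score_gap_le.
Qed.

Lemma responsibility_gradient_bound a u eta k : 0 <= eta ->
  dominant alpha sigma x0 t (row_mx a u) eta k ->
  norm2 (grad_a (w k) a u) <= total_score_gap * eta /\
  \sum_(j < N | j != k) norm2 (grad_a (w j) a u) <= total_score_gap * eta.
Proof.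
move=> eta_ge0 dom.
pose p j (b : 'rV[R]_da) := component alpha sigma x0 t (row_mx b u) j.
have p_gt0 j b : 0 < p j b by exact: component_gt0.
have w_ge0 j : 0 <= w j (row_mx a u) := normalized_weight_ge0 p_gt0 j a.
have w_le1 j : w j (row_mx a u) <= 1 := normalized_weight_le1 p_gt0 j a.
have others : \sum_(j < N | j != k) w j (row_mx a u) <= eta :=
  sum_others_le p_gt0 eta_ge0 dom.
(* For [j != k] this sum contains the dominant weight [w k], so only the trivial bound is available;
   the smallness then comes from [w j]. *)
have others_le1 j : \sum_(l < N | l != j) w l (row_mx a u) <= 1.
  rewrite -(sum_normalized_weights p_gt0 k a) [leRHS](bigD1 j)//= lerDr.
  exact: w_ge0.
split.
- apply: (le_trans (norm2_grad_a_le _ _ _)).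
  rewrite ler_wpM2l ?total_score_gap_ge0//; apply: le_trans others.
  by rewrite ler_piMl// sumr_ge0.
- apply: (@le_trans _ _ (\sum_(j < N | j != k) total_score_gap * w j (row_mx a u))).
    apply: ler_sum => j _; apply: (le_trans (norm2_grad_a_le _ _ _)).
    by rewrite ler_wpM2l ?total_score_gap_ge0// ler_piMr.
  by rewrite -mulr_sumr ler_wpM2l// total_score_gap_ge0.
Qed.

End responsibility_gradient.

(* The gradients exist; they are O(eta), with a constant that depends only on
   the training set, alpha and sigma and the time t; and they tend to 0 with
   eta.  The uniformity in x is what gives O(eta) its content: at a fixed x the
   admissible eta may be bounded away from 0. *)
Theorem theoremE1 (R : realType) (N da du : nat) (alpha sigma : R -> R)
    (x0 : 'I_N -> 'rV[R]_(da + du)) (t : R) (sigma_gt0 : 0 < sigma t) :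
  let w (n : 'I_N) (x : 'rV[R]_(da + du)) :=
    responsibility alpha sigma x0 t x n in
  [/\ forall (a : 'rV[R]_da) (u : 'rV[R]_du) (n : 'I_N),
        differentiable (fun a' : 'rV[R]_da => w n (row_mx a' u)) a,
      exists C : R,
        forall (a : 'rV[R]_da) (u : 'rV[R]_du) (eta : R) (k : 'I_N),
          0 < eta < 1 ->
          dominant alpha sigma x0 t (row_mx a u) eta k ->
          norm2 (grad_a (w k) a u) <= C * eta /\
          \sum_(j < N | j != k) norm2 (grad_a (w j) a u) <= C * eta
    & forall eps : R, 0 < eps ->
        \forall eta \near 0^'+,
          forall (a : 'rV[R]_da) (u : 'rV[R]_du) (k : 'I_N),
            dominant alpha sigma x0 t (row_mx a u) eta k ->
            norm2 (grad_a (w k) a u) < eps /\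
            \sum_(j < N | j != k) norm2 (grad_a (w j) a u) < eps].
Proof.
split.
- by move=> a u n; exact: differentiable_responsibility.
- exists (total_score_gap alpha sigma x0 t) => a u eta k /andP[/ltW eta_ge0 _].
  exact: responsibility_gradient_bound.
- move=> eps eps_gt0; set K := total_score_gap alpha sigma x0 t.
  have K_ge0 : 0 <= K by exact: total_score_gap_ge0.
  (* [K] may be 0, for instance when all samples share their [a]-part, so the threshold for [eta] is
     [eps / (K + 1)]. *)
  have K1_gt0 : 0 < K + 1 by rewrite ltr_wpDl.
  near=> eta => a u k dom.
  have eta_gt0 : 0 < eta by near: eta; exact: nbhs_right_gt.
  have Keta : K * eta < eps.
    apply: (@le_lt_trans _ _ ((K + 1) * eta)).
      by rewrite ler_pM2r// lerDl.
    rewrite mulrC -ltr_pdivlMr//; near: eta.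
    by apply: nbhs_right_lt; rewrite divr_gt0.
  have [] := responsibility_gradient_bound sigma_gt0 (ltW eta_gt0) dom.
  by move=> wk wj; split; exact: le_lt_trans Keta.
Unshelve. all: by end_near.
Qed.
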